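(* Let $G$ be a finite graph for which there exist $\alpha>0$ and a constant $C>0$ (depending on $G$ and $\alpha$) with $$\mathrm{ex}(n,G)\le C\,n^{2-\alpha}\qquad\text{for all } n\in\mathbb{N}.$$ There exists a constant $c>0$, depending only on $G$ and $\alpha$, such that for every power $q$ of an odd prime and every integer $d\ge1$, if $E\subset\mathbb{F}_q^d$ is a set satisfying $$|E|\ge c\,q^{\max\left(\frac{d+1}{2},\frac1\alpha\right)},$$ then $\Delta_G(E)\supset\mathbb{F}_q\setminus\{0\}$.
   Context: Graphs are simple and undirected; subgraphs need not be induced. For a finite graph $G$ and $n\in\mathbb{N}$ ($n\ge1$), the extremal number $\mathrm{ex}(n,G)$ is the largest number of edges in any graph on $n$ vertices which does not have a subgraph isomorphic to $G$. $\mathbb{F}_q$ is the field with $q$ elements, $q$ a power of an odd prime. For $x\in\mathbb{F}_q^d$ put $\|x\|=x_1^2+\cdots+x_d^2\in\mathbb{F}_q$. For $E\subset\mathbb{F}_q^d$ and $t\in\mathbb{F}_q$, the $t$-distance graph $\mathcal{G}_t(E)$ has vertex set $E$, with $x\sim y$ if and only if $\|x-y\|=t$. The $G$-distance set is $\Delta_G(E)=\{t\in\mathbb{F}_q:\mathcal{G}_t(E)\text{ contains a subgraph isomorphic to }G\}$. *)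

(* Defs.v *)
From mathcomp Require Import all_boot all_order all_algebra.
From mathcomp Require Import all_classical all_reals all_analysis.

Set Implicit Arguments.
Unset Strict Implicit.
Unset Printing Implicit Defensive.

Import Order.TTheory GRing.Theory Num.Theory.
Local Open Scope classical_set_scope.
Local Open Scope ring_scope.

Record sgraph := SGraph {
  vertex :> finType;
  adj : rel vertex;
  adj_sym : symmetric adj;
  adj_irrefl : irreflexive adj }.

Definition edges (H : sgraph) : {set {set H}} :=
  [set [set x; y]%SET | x in H, y in H & adj x y]%SET.

Definition graph_iso (G H : sgraph) : Prop :=
  exists f : G -> H, bijective f /\ forall x y, adj (f x) (f y) = adj x y.

(* Not necessarily induced: [sub_adj] may omit edges of [H] inside
   [sub_vertices]. *)
Record subgraph (H : sgraph) := Subgraph {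
  sub_vertices : {set H};
  sub_adj : rel H;
  sub_adj_sym : symmetric sub_adj;
  sub_adj_incident : forall x y, sub_adj x y -> x \in sub_vertices;
  sub_adj_adj : subrel sub_adj (@adj H) }.

Definition subgraph_adj (H : sgraph) (S : subgraph H) :
    rel {x : H | x \in sub_vertices S} :=
  fun x y => sub_adj S (val x) (val y).

Lemma subgraph_adj_sym (H : sgraph) (S : subgraph H) :
  symmetric (@subgraph_adj H S).
Proof. by move=> x y; exact: sub_adj_sym. Qed.

Lemma subgraph_adj_irrefl (H : sgraph) (S : subgraph H) :
  irreflexive (@subgraph_adj H S).
Proof.
move=> x; apply/negP => /sub_adj_adj.
by rewrite adj_irrefl.
Qed.

Definition subgraph_graph (H : sgraph) (S : subgraph H) : sgraph :=
  SGraph (@subgraph_adj_sym H S) (@subgraph_adj_irrefl H S).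

Definition contains_copy (H G : sgraph) : Prop :=
  exists S : subgraph H, graph_iso G (subgraph_graph S).

(* A graph on n vertices has at most 'C(n, 2) edges, so the bound on m loses
   nothing (see [edges_le_extremal]).  The value is 0 if every graph on n
   vertices contains G, i.e. if G has no edge and at most n vertices. *)
Definition extremal_number (n : nat) (G : sgraph) : nat :=
  (\max_(m < ('C(n, 2)).+1 |
     `[< exists H : sgraph,
           [/\ #|H| = n, ~ contains_copy H G & #|edges H| = m] >]) m)%N.

Lemma card_edges_le (H : sgraph) : (#|edges H| <= 'C(#|H|, 2))%N.
Proof.
rewrite -(card_draws H 2); apply/subset_leq_card/fintype.subsetP => A.
case/imset2P => x y _; rewrite inE => /andP[_ xy] ->.
rewrite inE cards2; case: (eqVneq x y) xy => // ->.
by rewrite adj_irrefl.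
Qed.

Lemma edges_le_extremal (H G : sgraph) :
  ~ contains_copy H G -> (#|edges H| <= extremal_number #|H| G)%N.
Proof.
move=> HG; have lt_m : (#|edges H| < ('C(#|H|, 2)).+1)%N.
  by rewrite ltnS card_edges_le.
apply: (@leq_bigmax_cond _ _ _ (Ordinal lt_m)).
by apply/asboolP; exists H.
Qed.

Definition sqnorm (F : finFieldType) (d : nat) (x : 'rV[F]_d) : F :=
  \sum_(i < d) x 0 i ^+ 2.

(* The condition x != y discards the loops that t = 0 would create; it is
   automatic for t != 0. *)
Definition dist_adj (F : finFieldType) (d : nat) (t : F)
    (E : {set 'rV[F]_d}) :
    rel {x : 'rV[F]_d | x \in E} :=
  fun x y => (x != y) && (sqnorm (val x - val y) == t).

Lemma dist_adj_sym (F : finFieldType) (d : nat) (t : F)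
    (E : {set 'rV[F]_d}) :
  symmetric (@dist_adj F d t E).
Proof.
move=> x y; rewrite /dist_adj eq_sym; congr (_ && (_ == _)).
by apply: eq_bigr => i _; rewrite -opprB mxE sqrrN.
Qed.

Lemma dist_adj_irrefl (F : finFieldType) (d : nat) (t : F)
    (E : {set 'rV[F]_d}) :
  irreflexive (@dist_adj F d t E).
Proof. by move=> x; rewrite /dist_adj eqxx. Qed.

Definition distance_graph (F : finFieldType) (d : nat) (t : F)
    (E : {set 'rV[F]_d}) : sgraph :=
  SGraph (@dist_adj_sym F d t E) (@dist_adj_irrefl F d t E).

Definition distance_set (G : sgraph) (F : finFieldType) (d : nat)
    (E : {set 'rV[F]_d}) : set F :=
  [set t : F | contains_copy (distance_graph t E) G].

Definition odd_prime_power (q : nat) : Prop :=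
  exists p k : nat, [/\ prime p, odd p, (0 < k)%N & q = (p ^ k)%N].

(* Main.v *)
Require Import Defs.
From mathcomp Require Import all_boot all_order all_algebra.
From mathcomp Require Import all_fingroup all_field all_character.
From mathcomp Require Import ring zify.
From mathcomp Require Import all_classical all_reals all_analysis.

(* By Fourier analysis on [F_q^d], the number N of ordered pairs of [E] at
   distance [t != 0] satisfies [|q N - |E|^2| <= 3 q^((d+1)/2) |E|] as soon as
   [|\sum_(s != 0) conj(G_s)^d psi (a s + b / s)|^2 <= 9 q^(d+1)] for [b != 0],
   where [G_s] is the quadratic Gauss sum.  Hence [|E| >= 6 q^((d+1)/2)] gives
   at least [|E|^2 / (4 q)] edges in the [t]-distance graph, which exceeds
   [ex(|E|, G)] once [|E|^alpha > 4 C q].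
   For odd [d] the inner sum is a Salie sum, evaluated by completing a square.
   For even [d] it is a Kloosterman sum, for which the Weil bound is needed, up
   to the constant.  If [K_m] is the sum lifted to the extension of degree
   [2^m], counting elements of given trace and norm in a quadratic extension
   gives [K_(m+1) + K_m^2 = 2 q^(2^m)], while Stepanov's polynomial method
   gives [K_(m+1) = O(q^(2^m))] with a constant independent of [m].  If
   [|K_0| > 3 sqrt q], the recursion contradicts the second bound. *)

Set Implicit Arguments.
Unset Strict Implicit.
Unset Printing Implicit Defensive.

Import Order.TTheory GRing.Theory Num.Theory.
Local Open Scope ring_scope.

(** * Character sums *)

Lemma sum_fibers (U T : finType) (h : U -> T) (g : T -> algC) :
  \sum_u g (h u) = \sum_w g w *+ #|[set u | h u == w]|.
Proof.
rewrite (partition_big h xpredT) //=; apply: eq_bigr => w _.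
rewrite (eq_bigr (fun=> g w)) => [|u /eqP -> //].
by rewrite sumr_const; congr (_ *+ _); apply: eq_card => u; rewrite !inE.
Qed.

Lemma sum_card_fibers (U T : finType) (h : U -> T) :
  (\sum_w #|[set u | h u == w]| = #|U|)%N.
Proof.
rewrite -sum1_card (partition_big h xpredT) //=; apply: eq_bigr => w _.
by rewrite sum1_card; apply: eq_card => u; rewrite !inE.
Qed.

(** Turns an upper bound on each fibre and a count of the total into exact counts, so that only
    upper bounds need a case analysis. It serves the square and nonsquare fibres and the trace-norm
    fibres. *)
Lemma sum_leq_const_eq (T : finType) (f : T -> nat) (m : nat) :
  (forall w, (f w <= m)%N) -> (\sum_w f w = m * #|T|)%N ->
  forall w, f w = m.
Proof.
move=> le_fm sum_f w; apply/eqP.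
have := leqif_sum (fun i _ => leqif_eq (le_fm i)).
move=> /(_ xpredT)[_]; rewrite sum_nat_const sum_f.
rewrite cardT -cardE mulnC eqxx => /esym/forallP/(_ w).
by rewrite implyTb.
Qed.

Definition additive_character (F : finFieldType) (psi : F -> algC) : Prop :=
  [/\ {morph psi : x y / x + y >-> x * y}, (forall x, `|psi x| = 1)
    & exists u, psi u != 1].

Lemma exists_additive_character (F : finFieldType) :
  exists psi : F -> algC, additive_character psi.
Proof.
pose G := [set: F]%G.
have abG : abelian G.
  by apply/centsP => x _ y _; rewrite /commute /= ; apply: addrC.
have cardG : (1 < Nirr G)%N.
  move: abG; rewrite card_classes_abelian -NirrE => /eqP ->.
  by rewrite cardsT card_finNzRing_gt1.
(* [i] is the index 1; index 0 is the trivial character, so ['chi_i] is not trivial. *)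
pose i : Iirr G := Ordinal cardG.
have lin : 'chi_i \is a linear_char by apply/char_abelianP.
exists 'chi_i; split.
- by move=> x y; rewrite -lin_charM ?inE.
- by move=> x; rewrite normC_lin_char ?inE.
apply/existsP; apply: contraT; rewrite negb_exists => /forallP all1.
suff : i = 0 by [].
apply: irr_inj; rewrite irr0; apply/cfunP => x; rewrite cfun1E inE /=.
by apply/eqP; have := all1 x; rewrite negbK.
Qed.

Section CharacterSums.

Variables (F : finFieldType) (psi : F -> algC).
Hypothesis psiP : additive_character psi.

Lemma charD x y : psi (x + y) = psi x * psi y.
Proof. by case: psiP. Qed.

Lemma norm_char x : `|psi x| = 1.
Proof. by case: psiP. Qed.

Lemma char_neq0 x : psi x != 0.
Proof. by rewrite -normr_gt0 norm_char. Qed.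

Lemma char0 : psi 0 = 1.
Proof. by apply: (mulIf (char_neq0 0)); rewrite -charD addr0 mul1r. Qed.

Lemma charN x : psi (- x) = (psi x)^*.
Proof.
apply: (mulfI (char_neq0 x)); rewrite -charD subrr char0.
by rewrite -normCK norm_char expr1n.
Qed.

Lemma char_sum (I : Type) (r : seq I) (P : pred I) (f : I -> F) :
  psi (\sum_(i <- r | P i) f i) = \prod_(i <- r | P i) psi (f i).
Proof. exact: (big_morph psi charD char0). Qed.

Lemma sum_char a :
  \sum_x psi (a * x) = if a == 0 then #|F|%:R else 0.
Proof.
have [->|a0] := eqVneq.
  rewrite (eq_bigr (fun=> 1)) => [|x _]; last by rewrite mul0r char0.
  by rewrite sumr_const.
case: psiP => _ _ [u u1].
set S := \sum_x _.
(* Translating [x] by [u / a] multiplies the sum by [psi u], which is not 1. *)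
have : S = psi u * S.
  rewrite {1}/S (reindex_onto (fun x => x + u / a) (fun x => x - u / a)) /=; last first.
    by move=> x _; rewrite subrK.
  rewrite mulr_sumr; apply: eq_big => [x|x _]; first by rewrite addrK eqxx.
  by rewrite mulrDr mulrCA divff // mulr1 charD mulrC.
move/eqP; rewrite -subr_eq0 -{1}[S]mul1r -mulrBl mulf_eq0 subr_eq0 eq_sym.
by rewrite (negPf u1) => /eqP.
Qed.

Lemma sum_char_neq0 a :
  \sum_(x | x != 0) psi (a * x) = (if a == 0 then #|F|%:R else 0) - 1.
Proof.
rewrite -sum_char [in RHS](bigD1 (0 : F)) //= mulr0 char0.
by rewrite addrAC subrr add0r.
Qed.

Hypothesis two_neq0 : 2%:R != 0 :> F.

Lemma card_sqrt_le (w : F) : (#|[set u : F | u ^+ 2 == w]| <= 2)%N.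
Proof.
have [->|/set0Pn [v]] := eqVneq [set u : F | u ^+ 2 == w] finset.set0.
  by rewrite cards0.
rewrite inE => /eqP <-.
apply: leq_trans (subset_leq_card (_ : _ \subset [set v; - v])) _.
  by apply/fintype.subsetP => u; rewrite !inE eqf_sqr.
by rewrite cards2; case: (v != - v).
Qed.

(** * Quadratic Gauss sums and Salie sums *)

Definition gauss_sum (s : F) : algC := \sum_u psi (s * u ^+ 2).

Lemma gauss_sum_sqr (s v : F) : v != 0 -> gauss_sum (s * v ^+ 2) = gauss_sum s.
Proof.
move=> v0; rewrite /gauss_sum [RHS](reindex_inj (mulfI v0)) /=.
by apply: eq_bigr => u _; congr psi; ring.
Qed.

Lemma conj_gauss_sum s : (gauss_sum s)^* = gauss_sum (- s).
Proof.
by rewrite rmorph_sum; apply: eq_bigr => u _; rewrite mulNr charN.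
Qed.

Lemma norm_gauss_sum s : s != 0 -> `|gauss_sum s| ^+ 2 = #|F|%:R.
Proof.
move=> s0; rewrite normCK conj_gauss_sum mulrC /gauss_sum mulr_suml.
(* Replacing [w] by [u + w] makes the phase linear in [u] with slope [2 s w], so only [w = 0]
   survives the sum over [u]. *)
transitivity (\sum_u \sum_w psi (s * w ^+ 2) * psi (2%:R * s * w * u)).
  apply: eq_bigr => u _; rewrite mulr_sumr (reindex_inj (addrI u)) /=.
  by apply: eq_bigr => w _; rewrite -!charD; congr psi; ring.
rewrite exchange_big (bigD1 0) //= [X in _ + X]big1 => [|w w0].
  by rewrite addr0 -mulr_sumr expr0n mulr0 char0 mul1r mulr0 sum_char eqxx.
have nz : 2%:R * s * w != 0 by rewrite !mulf_neq0.
by rewrite -mulr_sumr sum_char (negPf nz) mulr0.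
Qed.

(** The maps [u ^+ 2] and [n * u ^+ 2] together hit every element exactly twice, so the two Gauss
    sums add up to twice a full character sum, which is 0. *)
Lemma gauss_sum_nonsquare (n s : F) :
  s != 0 -> (forall v, v ^+ 2 != n) -> gauss_sum (n * s) = - gauss_sum s.
Proof.
move=> s0 nsq; have n0 : n != 0 by have := nsq 0; rewrite expr0n eq_sym.
pose cnt w := (#|[set u : F | (u ^+ 2)%R == w]| + #|[set u : F | (n * u ^+ 2)%R == w]|)%N.
have cnt2 : forall w, cnt w = 2%N.
  apply: sum_leq_const_eq => [w|]; last first.
    by rewrite big_split /= !sum_card_fibers mul2n addnn.
  have [->|w0] := eqVneq w 0.
    rewrite /cnt (_ : [set u | u ^+ 2 == 0] = [set 0]).
      rewrite (_ : [set u | n * u ^+ 2 == 0] = [set 0]) ?cards1 //.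
      by apply/setP => u; rewrite !inE mulf_eq0 (negPf n0) expf_eq0.
    by apply/setP => u; rewrite !inE expf_eq0.
  have [e0|/set0Pn [v]] := eqVneq [set u : F | u ^+ 2 == w] finset.set0.
    rewrite /cnt e0 cards0 add0n.
    rewrite (_ : [set u | _] = [set u | u ^+ 2 == w / n]) ?card_sqrt_le //.
    by apply/setP => u; rewrite !inE mulrC eq_sym -(can2_eq (mulfVK n0) (mulfK n0)) eq_sym.
  rewrite inE => /eqP vw.
  rewrite /cnt (_ : [set u | n * u ^+ 2 == w] = finset.set0) ?cards0 ?addn0 ?card_sqrt_le //.
  apply/setP => u; rewrite !inE; apply/negP => /eqP uw.
  have u0 : u != 0 by apply: contraNneq w0 => u0; rewrite -uw u0 expr0n mulr0.
  have /eqP := nsq (v / u); apply.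
  by rewrite expr_div_n vw -uw mulfK // expf_neq0.
apply/eqP; rewrite -addr_eq0 addrC; apply/eqP.
rewrite /gauss_sum; under [X in _ + X]eq_bigr => u _ do rewrite -mulrA mulrCA.
rewrite (sum_fibers (fun u => u ^+ 2) (fun w => psi (s * w))).
rewrite (sum_fibers (fun u => n * u ^+ 2) (fun w => psi (s * w))) -big_split /=.
rewrite (eq_bigr (fun w => psi (s * w) *+ 2)) => [|w _]; last first.
  by rewrite -mulrnDr; congr (_ *+ _); exact: cnt2.
by rewrite sumrMnl sum_char (negPf s0) mul0rn.
Qed.

(** The sign is the quadratic character of [n]; what matters later is that it does not depend on
    [s]. *)
Lemma gauss_sum_sign (n : F) : n != 0 ->
  exists e : bool, forall s, s != 0 -> gauss_sum (n * s) = (-1) ^+ e * gauss_sum s.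
Proof.
move=> n0; have [/existsP[v /eqP vn]|nsq] := boolP [exists v, v ^+ 2 == n].
  exists false => s s0; rewrite mul1r mulrC -vn gauss_sum_sqr //.
  by apply: contraNneq n0 => v0; rewrite -vn v0 expr0n.
exists true => s s0; rewrite mulN1r gauss_sum_nonsquare // => v.
by apply: contra nsq => vn; apply/existsP; exists v.
Qed.

(** For [s != 0], [gauss_sum s] is the quadratic character of [s] times [gauss_sum 1], so this is
    the classical Salie sum scaled by [gauss_sum 1]. *)
Definition salie_sum (a b : F) : algC :=
  \sum_(s | s != 0) gauss_sum s * psi (a * s + b / s).

Lemma salie_sumC a b : salie_sum a b = salie_sum b a.
Proof.
rewrite /salie_sum (reindex_inj invr_inj) /=.
apply: eq_big => [s|s]; rewrite invr_eq0 // => s0.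
rewrite invrK addrC; congr (_ * _).
by rewrite -(gauss_sum_sqr _ s0) expr2 mulrA mulVf // mul1r.
Qed.

(** With [b = -1], shifting [u] by [1 / s] in the Gauss sum cancels the pole: the phase becomes
    [(a + u^2) s + 2 u]. Summing over [s] leaves only the at most two [u] with [u^2 = - a]. *)
Lemma norm_salie_sum_unit a : `|salie_sum a (-1)| <= 2%:R * #|F|%:R.
Proof.
have -> : salie_sum a (-1) = #|F|%:R * \sum_(u | u ^+ 2 == - a) psi (2%:R * u).
  transitivity (\sum_(s | s != 0) \sum_u psi (2%:R * u) * psi ((a + u ^+ 2) * s)).
    apply: eq_bigr => s s0.
    rewrite /gauss_sum mulr_suml (reindex_inj (addrI s^-1)) /=.
    by apply: eq_bigr => u _; rewrite -!charD; congr psi; field.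
  rewrite exchange_big /=.
  transitivity (\sum_u psi (2%:R * u) * (if u ^+ 2 == - a then #|F|%:R else 0)
     - \sum_u psi (2%:R * u)).
    rewrite -sumrB; apply: eq_bigr => u _.
    by rewrite -mulr_sumr sum_char_neq0 mulrBr mulr1 (addrC a) addr_eq0.
  rewrite sum_char (negPf two_neq0) subr0 mulr_sumr [RHS]big_mkcond /=.
  by apply: eq_bigr => u _; case: ifP; rewrite ?mulr0 // mulrC.
rewrite normrM normr_nat mulrC ler_wpM2r ?ler0n //.
apply: le_trans (ler_norm_sum _ _ _) _.
rewrite (eq_bigr (fun=> 1)) => [|u _]; last exact: norm_char.
rewrite sumr_const ler_nat; apply: leq_trans (card_sqrt_le (- a)).
by apply/eq_leq/eq_card => u; rewrite inE.
Qed.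

(** After swapping the coefficients, rescaling [s] by [- a] turns the coefficient of [1 / s] into
    -1, at the cost of a sign from the Gauss sum. *)
Lemma norm_salie_sum a b : a != 0 -> `|salie_sum a b| <= 2%:R * #|F|%:R.
Proof.
move=> a0; have na0 : - a != 0 by rewrite oppr_eq0.
have [e eP] := gauss_sum_sign na0.
suff -> : `|salie_sum a b| = `|salie_sum (- a * b) (-1)| by apply: norm_salie_sum_unit.
rewrite salie_sumC (_ : salie_sum b a = (-1) ^+ e * salie_sum (- a * b) (-1)).
  by rewrite normrMsign.
rewrite /salie_sum (reindex_inj (mulfI na0)) /= mulr_sumr.
apply: eq_big => [s|s]; rewrite mulf_eq0 (negPf na0) // => s0.
rewrite eP // -mulrA; congr (_ * (_ * psi _)).
by field; rewrite ?mulf_neq0 ?s0 ?na0 ?a0.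
Qed.

End CharacterSums.

(** * Stepanov's method *)

(** The coefficients have degree below [l], so the degrees of the products [nu k * P k] lie in
    disjoint windows of length [l] and the top nonzero product cannot be cancelled. *)
Lemma graded_independence (R : idomainType) (l c n : nat)
    (P nu : nat -> {poly R}) :
  (forall k, (k < n)%N -> size (P k) = (k * l + c).+1) ->
  (forall k, (k < n)%N -> (size (nu k) <= l)%N) ->
  \sum_(k < n) nu k * P k = 0 -> forall k, (k < n)%N -> nu k = 0.
Proof.
elim: n => // n IH szP sznu.
rewrite big_ord_recr /= => sum0.
have szsum : (size (\sum_(k < n) nu k * P k)%R <= n * l + c)%N.
  apply: (leq_trans (size_sum _ _ _)); apply/bigmax_leqP => k _.
  have kn : (k < n.+1)%N by apply: leq_trans (ltn_ord k) _.
  apply: (leq_trans (size_polyMleq _ _)); rewrite szP // addnS /= addnA leq_add2r.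
  apply: (@leq_trans (k.+1 * l)); first by rewrite mulSn leq_add2r sznu.
  by rewrite leq_mul2r ltn_ord orbT.
have nun : nu n = 0.
  apply/eqP; apply: contraLR szsum => nu0; rewrite -ltnNge.
  have Pn0 : P n != 0 by rewrite -size_poly_eq0 szP.
  have /eqP := sum0; rewrite addr_eq0 => /eqP ->.
  rewrite size_polyN size_mul // szP // addnS /= -[X in (X < _)%N]add0n ltn_add2r.
  by rewrite lt0n size_poly_eq0.
move=> k; rewrite ltnS leq_eqVlt => /predU1P[-> //|].
apply: IH => [j jn|j jn|]; [exact/szP/ltnW|exact/sznu/ltnW|].
by move: sum0; rewrite nun mul0r addr0.
Qed.

(* Pigeonhole: there are more coefficient tuples than possible values of the sum. *)
Lemma exists_composed_relation (F : finFieldType) (n l L s : nat)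
    (S : nat -> {poly F}) :
  (0 < l)%N -> (forall k, (k < n)%N -> (size (S k) <= s)%N) ->
  (l.-1 * L + s < n * l)%N ->
  exists nu : nat -> {poly F},
    [/\ forall k, (size (nu k) <= l)%N, exists2 k, (k < n)%N & nu k != 0
      & \sum_(k < n) (nu k \Po 'X^L) * S k = 0].
Proof.
move=> l0 szS lt_s.
pose f (M : 'M[F]_(n, l)) := \sum_(k < n) (rVpoly (row k M) \Po 'X^L) * S k.
have szf M : (size (f M) <= l.-1 * L + s)%N.
  apply: (leq_trans (size_sum _ _ _)); apply/bigmax_leqP => k _.
  apply: (leq_trans (size_polyMleq _ _)).
  apply: (@leq_trans ((l.-1 * L).+1 + s).-1); last by rewrite addSn.
  rewrite -!subn1 leq_sub2r // leq_add ?szS //.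
  apply: (leq_trans (size_comp_poly_leq _ _)); rewrite ltnS size_polyXn /=.
  have szr : (size (rVpoly (row k M)) <= l)%N by exact: size_poly.
  by rewrite leq_mul2r; apply/orP; right; rewrite -!subn1 leq_sub2r.
have /injectivePn[M1 [M2 neqM eqf]] :
    ~~ injectiveb (fun M => poly_rV (f M) : 'rV_(l.-1 * L + s)).
  apply/negP => /injectiveP /leq_card; rewrite !card_mx mul1n.
  by rewrite leq_exp2l ?card_finNzRing_gt1 // leqNgt lt_s.
have fB : f (M1 - M2) = 0.
  transitivity (f M1 - f M2).
    rewrite /f -sumrB; apply: eq_bigr => k _.
    by rewrite -mulrBl -comp_polyB -linearB /= linearB.
  by rewrite -[f M1](poly_rV_K (szf M1)) eqf (poly_rV_K (szf M2)) subrr.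
pose nu k := if insub k is Some i then rVpoly (row i (M1 - M2)) else 0.
have nuE (i : 'I_n) : nu i = rVpoly (row i (M1 - M2)) by rewrite /nu valK.
exists nu; split.
- move=> k; rewrite /nu; case: insubP => [i _ _|_]; first exact: size_poly.
  by rewrite size_poly0.
- have /existsP[i ri] : [exists i, row i (M1 - M2) != 0].
    move: neqM; rewrite -subr_eq0; apply: contraR => /existsPn r0.
    by apply/eqP/row_matrixP => i; rewrite row0; have := r0 i; rewrite negbK => /eqP.
  exists i => //; rewrite nuE; apply: contraNneq ri => r0.
  by rewrite -[row i _]rVpolyK r0 linear0.
- by rewrite -[RHS]fB; apply: eq_bigr => k _; rewrite nuE.
Qed.

(** * Powers of the Frobenius map of a subfield *)

Section FrobeniusPowers.

Variables (F K : finFieldType) (iota : {rmorphism F -> K}).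
Local Notation q := #|F|.

Lemma pchar_card_nat e : [pchar K].-nat (q ^ e)%N.
Proof.
have [p p_pr pF] := finPcharP F.
have pK : p \in [pchar K] by rewrite (rmorph_pchar iota).
rewrite (eq_pnat _ (GRing.pcharf_eq pK)) pnatX; apply/orP; left.
have := card_pprimeChar pF; rewrite /pPrimeCharType /= => ->.
by rewrite pnatX pnat_id.
Qed.

Lemma frobeniusD e (x y : K) :
  (x + y) ^+ (q ^ e)%N = x ^+ (q ^ e)%N + y ^+ (q ^ e)%N.
Proof. exact/GRing.exprDn_pchar/pchar_card_nat. Qed.

Lemma frobenius_sum e (I : Type) (r : seq I) (P : pred I) (f : I -> K) :
  (\sum_(i <- r | P i) f i) ^+ (q ^ e)%N = \sum_(i <- r | P i) f i ^+ (q ^ e)%N.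
Proof.
have z : 0 ^+ (q ^ e)%N = 0 :> K.
  by rewrite expr0n expn_eq0 eqn0Ngt (ltnW (card_finNzRing_gt1 F)).
exact: (big_morph _ (frobeniusD e) z).
Qed.

Lemma frobenius_iota e (a : F) : iota a ^+ (q ^ e)%N = iota a.
Proof.
by elim: e => [|e IH]; rewrite ?expr1 // expnSr exprM IH -rmorphXn expf_card.
Qed.

Lemma frobenius_horner e (p : {poly F}) (x : K) :
  (map_poly iota p).[x] ^+ (q ^ e)%N = (map_poly iota (p \Po 'X^(q ^ e))).[x].
Proof.
rewrite map_comp_poly map_polyXn horner_comp hornerXn.
rewrite !horner_coef frobenius_sum size_map_poly.
by apply: eq_bigr => i _; rewrite coef_map exprMn frobenius_iota exprAC.
Qed.

End FrobeniusPowers.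

Section Stepanov.

Variables (F K : finFieldType) (iota : {rmorphism F -> K}) (a b c : F) (h : nat).
Hypothesis a_neq0 : a != 0.
Local Notation q := #|F|.
Local Notation l := (q ^ h)%N.
Local Notation L := (q ^ h.+1)%N.
Hypothesis card_K : #|K| = (L ^ 2)%N.

(* [T] is [X^l] times the partial trace [\sum_(e <= h) (a X + b / X)^(q^e)]. *)
Let T : {poly F} := \sum_(e < h.+1) (a *: 'X^(l + q ^ e) + b *: 'X^(l - q ^ e)).
(** With [k = i q + j], the last power of [X] pads [X^(i L) T^j] so that its degree is exactly
    [(k + q - 1) l], as [graded_independence] wants. [S k] is the low-degree polynomial that
    replaces the [L]-th power of [P k] on the counted points, up to powers of [x ^+ l]. *)
Let P k : {poly F} := 'X^(k %/ q * L) * T ^+ (k %% q) * 'X^((q.-1 - k %% q) * l).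
Let S k : {poly F} :=
  'X^(k %/ q) * (c *: 'X^l - T) ^+ (k %% q) * 'X^((q.-1 - k %% q) * l).

Let q_gt1 : (1 < q)%N. Proof. exact: card_finNzRing_gt1. Qed.
Let l_gt0 : (0 < l)%N. Proof. by rewrite expn_gt0 (ltnW q_gt1). Qed.

Let size_T : size T = (2 * l).+1.
Proof.
rewrite /T big_ord_recr /= subnn addnn -mul2n addrCA size_polyDl.
  by rewrite size_scale // size_polyXn.
rewrite size_scale // size_polyXn ltnS.
apply: (leq_trans (size_polyD _ _)); rewrite geq_max; apply/andP; split.
  apply: (leq_trans (size_sum _ _ _)); apply/bigmax_leqP => e _.
  have lt_e : (q ^ e < l)%N by rewrite ltn_exp2l.
  apply: (leq_trans (size_polyD _ _)); rewrite geq_max.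
  apply/andP; split; apply: (leq_trans (size_scale_leq _ _)); rewrite size_polyXn.
    by rewrite mul2n -addnn ltn_add2l.
  by rewrite (leq_ltn_trans (leq_subr _ _)) // ltn_Pmull.
by apply: (leq_trans (size_scale_leq _ _)); rewrite size_polyXn muln_gt0.
Qed.

Let T_neq0 : T != 0. Proof. by rewrite -size_poly_eq0 size_T. Qed.

Let divn_modn_scale k : (k %/ q * L + k %% q * l = k * l)%N.
Proof. by rewrite expnS mulnA -mulnDl -divn_eq. Qed.

Let modn_pred_subK k : (q.-1 - k %% q + k %% q = q.-1)%N.
Proof. by rewrite subnK // -ltnS prednK ?ltn_mod ltnW. Qed.

Let size_P k : size (P k) = (k * l + q.-1 * l).+1.
Proof.
have szT : size (T ^+ (k %% q)) = (2 * l * (k %% q)).+1.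
  by rewrite -[size _]prednK ?lt0n ?size_poly_eq0 ?expf_neq0 // size_exp size_T.
rewrite /P size_mulXn ?mulf_neq0 ?expf_neq0 ?polyX_eq0 //.
rewrite mulrC size_mulXn ?expf_neq0 // szT -(divn_modn_scale k) -[in RHS](modn_pred_subK k).
by rewrite !addnS; congr _.+1; ring.
Qed.

Let size_S k : (k < q * (l + 2))%N ->
  (size (S k) <= l + 1 + q.-1 * (2 * l) + 1)%N.
Proof.
move=> lt_k.
have lt_i : (k %/ q < l + 2)%N by rewrite ltn_divLR ?(ltnW q_gt1) // mulnC.
have szc : (size ((c *: 'X^l - T) ^+ (k %% q))%R <= (2 * l * (k %% q)).+1)%N.
  apply: (leq_trans (size_poly_exp_leq _ _)); rewrite ltnS leq_mul2r; apply/orP; right.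
  have : (size (c *: 'X^l - T)%R <= (2 * l).+1)%N.
    apply: (leq_trans (size_polyD _ _)); rewrite geq_max size_polyN size_T leqnn andbT.
    by apply: (leq_trans (size_scale_leq _ _)); rewrite size_polyXn ltnS leq_pmull.
  by case: (size _).
have szm (p : {poly F}) m : (size (p * 'X^m)%R <= size p + m)%N.
  have [->|p0] := eqVneq p 0; first by rewrite mul0r size_poly0.
  by rewrite size_mulXn // addnC.
apply: (leq_trans (szm _ _)); rewrite mulrC.
apply: (leq_trans (leq_add (szm _ _) (leqnn _))).
apply: (leq_trans (leq_add (leq_add szc (leqnn _)) (leqnn _))).
rewrite -{2}(modn_pred_subK k); nia.
Qed.

(** The [q (l + 2)] polynomials [nu k] carry [L (l + 2)] free coefficients, while by [size_S] the
    sum to be killed has at most [(l + 1) L - l + 2]. The degrees of the [P k] keep the other sum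
    nonzero. *)
Lemma stepanov_polynomial : exists nu : nat -> {poly F},
  [/\ forall k, (size (nu k) <= l)%N,
      \sum_(k < q * (l + 2)) nu k * P k != 0
    & \sum_(k < q * (l + 2)) (nu k \Po 'X^L) * S k = 0].
Proof.
have [|nu [sznu [k kn nuk] sum0]] := exists_composed_relation (L := L) l_gt0 size_S.
  rewrite expnS.
  by move: l_gt0 q_gt1; move: (q ^ h)%N q => [//|l' [//|q' _ q'_gt0]] /=; nia.
exists nu; split => //; apply: contraNneq nuk => HP.
apply/eqP; apply: (graded_independence (P := P) (l := l) (c := q.-1 * l)) kn => //.
Qed.

Let partial_trace (x : K) := \sum_(e < h.+1) (iota a * x + iota b / x) ^+ (q ^ e)%N.

Let horner_T (x : K) : x != 0 ->
  (map_poly iota T).[x] = x ^+ l * partial_trace x.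
Proof.
move=> x0; rewrite /T rmorph_sum horner_sum mulr_sumr; apply: eq_bigr => e _.
rewrite rmorphD /= !map_polyZ !map_polyXn !hornerE.
rewrite (frobeniusD iota) !exprMn !(frobenius_iota iota) exprVn mulrDr.
rewrite exprD expfB_cond; last first.
  by rewrite (negPf x0) add0n leq_exp2l // -ltnS.
by congr (_ + _); rewrite mulrCA.
Qed.

(** [K] has degree [2 (h + 1)] over [F], so the right side is the full trace; prescribing it as [c]
    expresses the [L]-th power of the partial trace as [c] minus the partial trace. *)
Let partial_trace_exp (x : K) :
  partial_trace x + partial_trace x ^+ L =
    \sum_(e < h.+1 + h.+1) (iota a * x + iota b / x) ^+ (q ^ e)%N.
Proof.
rewrite big_split_ord /=; congr (_ + _).
rewrite (frobenius_sum iota); apply: eq_bigr => e _.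
by rewrite -exprM -expnD addnC.
Qed.

(* Bombieri's form of Stepanov's method: on the counted points
   [x^(L^2) = x] and [T^L = c - T], so that [H^L] and a combination of the
   [S k] vanish together. *)
Lemma stepanov_bound :
  (#|[set x : K | (x != 0) && (\sum_(e < h.+1 + h.+1)
       (iota a * x + iota b / x) ^+ (q ^ e)%N == iota c)]%R| <= L * l + 3 * L)%N.
Proof.
have [nu [sznu H0 SR]] := stepanov_polynomial.
set H := \sum_(k < _) _ in H0.
set A := [set x | _].
have H0' : map_poly iota H != 0 by rewrite map_poly_eq0.
have rootA : all (root (map_poly iota H)) (enum A).
  apply/allP => x; rewrite mem_enum inE => /andP[x0 /eqP tr].
  have tL : partial_trace x ^+ L = iota c - partial_trace x.
    by apply/eqP; rewrite eq_sym subr_eq addrC partial_trace_exp tr.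
  have xLL : (x ^+ L) ^+ L = x by rewrite -exprM -[in RHS](expf_card x) card_K.
  pose u := x ^+ l.
  have u0 : u != 0 by rewrite expf_neq0.
  (* The nonzero factor [u ^+ q.-1] balances the padding: at [x], the [L]-th power of [P k] times
     [u ^+ q.-1] equals [u ^+ (q.-1 * L)] times [S k]. *)
  suff : (map_poly iota H).[x] ^+ L * u ^+ q.-1 == 0.
    by rewrite mulf_eq0 !expf_eq0 (negPf x0) !andbF orbF => /andP[].
  rewrite /H rmorph_sum horner_sum (frobenius_sum iota) mulr_suml.
  suff -> : \sum_(k < q * (l + 2)) (map_poly iota (nu k * P k)).[x] ^+ L * u ^+ q.-1
    = u ^+ (q.-1 * L) * (map_poly iota (\sum_(k < q * (l + 2)) (nu k \Po 'X^L) * S k)).[x].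
    by rewrite SR rmorph0 horner0 mulr0.
  rewrite rmorph_sum horner_sum mulr_sumr; apply: eq_bigr => k _ /=.
  set i := (k %/ q)%N; set j := (k %% q)%N; set r := (q.-1 - j)%N.
  have rj : q.-1 = (r + j)%N by rewrite modn_pred_subK.
  have PE : (map_poly iota (P k)).[x] =
      (x ^+ L) ^+ i * (u ^+ j * partial_trace x ^+ j) * u ^+ r.
    rewrite /P 2!rmorphM /= !map_polyXn rmorphXn /= !hornerM !hornerXn horner_exp.
    by rewrite horner_T // exprMn -/u -/i -/j -/r mulnC exprM (mulnC r) [x ^+ (l * r)]exprM.
  have SE : (map_poly iota (S k)).[x] =
      x ^+ i * (u ^+ j * (iota c - partial_trace x) ^+ j) * u ^+ r.
    rewrite /S 2!rmorphM /= !map_polyXn rmorphXn rmorphB /= map_polyZ map_polyXn.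
    rewrite !hornerM !hornerXn horner_exp hornerD hornerN hornerZ hornerXn.
    rewrite horner_T // -/u -/i -/j -/r [iota c * _]mulrC -mulrBr exprMn.
    by rewrite (mulnC r) [x ^+ (l * r)]exprM.
  rewrite [map_poly iota (nu k * _)]rmorphM [map_poly iota (_ * S k)]rmorphM /=.
  rewrite !hornerM PE SE !exprMn (frobenius_horner iota) -tL.
  set w := (map_poly iota (nu k \Po _)).[x].
  rewrite ![_ ^+ i ^+ L]exprAC xLL ![_ ^+ j ^+ L]exprAC exprM rj !exprD.
  by rewrite [(_ * _) ^+ L]exprMn [u ^+ j ^+ L]exprAC; ring.
(* Each [nu k * P k] has degree below [(q (l + 2) + q - 1) l = L l + 3 L - l], which bounds the
   number of roots. *)
rewrite cardE -ltnS -addSn.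
apply: leq_trans (max_poly_roots H0' rootA (enum_uniq _)) _.
rewrite size_map_poly.
apply: (leq_trans (size_sum _ _ _)); apply/bigmax_leqP => k _.
apply: (leq_trans (size_polyMleq _ _)); rewrite size_P addnS /=.
have := sznu k; have := ltn_ord k; rewrite !expnS.
move: l_gt0 q_gt1; case: k => k kn /=; move: (size _) (q ^ h)%N q => s l q.
nia.
Qed.

End Stepanov.

(** * Kloosterman sums *)

(** If every element were a square, squaring would be injective by finiteness, although 1 and -1
    have the same square. *)
Lemma exists_nonsquare (F : finFieldType) :
  2%:R != 0 :> F -> exists n : F, forall v, v ^+ 2 != n.
Proof.
move=> two0.
have [/existsP[n /forallP sq]|] := boolP [exists n : F, forall v, v ^+ 2 != n].
  by exists n.
rewrite negb_exists => /forallP sq.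
pose rt (n : F) := odflt 0 [pick v | v ^+ 2 == n].
have rtK : cancel rt (fun v => v ^+ 2).
  move=> n; rewrite /rt; case: pickP => [v /eqP //|no].
  by have := sq n; rewrite negb_forall => /existsP[v]; rewrite negbK no.
have /eqP : (1 : F) = - 1.
  by apply: (can_inj (canF_sym rtK)); rewrite sqrrN.
by rewrite -subr_eq0 opprK (negPf two0).
Qed.

Lemma exists_quadratic_extension (F : finFieldType) :
  2%:R != 0 :> F ->
  exists (K : finFieldType) (iota : {rmorphism F -> K}), #|K| = (#|F| ^ 2)%N.
Proof.
move=> /exists_nonsquare[n nsq]; pose p : {poly F} := 'X^2 - n%:P.
have szp : size p = 3%N by rewrite size_XnsubC.
have p_irr : monic_irreducible_poly p.
  split; last by rewrite monicXnsubC.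
  apply: cubic_irreducible; rewrite ?szp // => x.
  by rewrite /root !hornerE subr_eq0; apply: nsq.
exists {poly %/ p with p_irr}, (qfpoly_const p_irr).
by rewrite card_qfpoly szp.
Qed.

(** [X^q - X] has at most [q] roots, and the image of [F] already supplies [q] of them. *)
Lemma frobenius_fixed (F K : finFieldType) (iota : {rmorphism F -> K}) (y : K) :
  y ^+ #|F| = y -> exists x, iota x = y.
Proof.
move=> yq; have q_gt1 : (1 < #|F|)%N := card_finNzRing_gt1 F.
pose p : {poly K} := 'X^#|F| - 'X.
have szp : size p = #|F|.+1 by rewrite size_polyDl size_polyXn // size_polyN size_polyX.
have p0 : p != 0 by rewrite -size_poly_eq0 szp.
have rootE z : root p z = (z ^+ #|F| == z) by rewrite /root !hornerE subr_eq0.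
have [/codomP[x ->]|ny] := boolP (y \in codom iota); first by exists x.
suff : (size (y :: codom iota) < size p)%N by rewrite szp /= size_codom ltnn.
apply: max_poly_roots => //=.
- rewrite rootE yq eqxx /=; apply/allP => _ /codomP[x ->].
  by rewrite rootE -rmorphXn expf_card.
- by rewrite ny /=; apply/injectiveP/fmorph_inj.
Qed.

Definition kloosterman_sum (F : finFieldType) (psi : F -> algC) (a b : F) : algC :=
  \sum_(x | x != 0) psi (a * x + b / x).

Lemma kloosterman_sumC (F : finFieldType) (psi : F -> algC) (a b : F) :
  kloosterman_sum psi a b = kloosterman_sum psi b a.
Proof.
rewrite /kloosterman_sum (reindex_inj invr_inj) /=.
by apply: eq_big => [x|x _]; rewrite ?invr_eq0 // invrK addrC.
Qed.

(** * Trace and norm in a quadratic extension, and the doubling relation *)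

Section QuadraticExtension.

Variables (F K : finFieldType) (iota : {rmorphism F -> K}).
Hypothesis two_neq0 : 2%:R != 0 :> F.
Hypothesis card_K : #|K| = (#|F| ^ 2)%N.
Local Notation q := #|F|.

Let frobD (x y : K) : (x + y) ^+ q = x ^+ q + y ^+ q.
Proof. by have := frobeniusD iota 1 x y; rewrite expn1. Qed.

Let frob_iota (x : F) : iota x ^+ q = iota x.
Proof. by rewrite -rmorphXn expf_card. Qed.

Let frobK (z : K) : z ^+ q ^+ q = z.
Proof. by rewrite -exprM mulnn -card_K expf_card. Qed.

Lemma exists_trace_norm : exists tn : (K -> F) * (K -> F),
  (forall z, iota (tn.1 z) = z + z ^+ q) /\ (forall z, iota (tn.2 z) = z * z ^+ q).
Proof.
have [tr trP] : exists tr : K -> F, forall z, iota (tr z) = z + z ^+ q.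
  pose tr z := odflt 0 [pick x | iota x == z + z ^+ q]; exists tr => z; rewrite /tr.
  case: pickP => [x /eqP //|no].
  have [|x xP] := frobenius_fixed iota (y := z + z ^+ q).
    by rewrite frobD frobK addrC.
  by have := no x; rewrite xP eqxx.
have [nm nmP] : exists nm : K -> F, forall z, iota (nm z) = z * z ^+ q.
  pose nm z := odflt 0 [pick x | iota x == z * z ^+ q]; exists nm => z; rewrite /nm.
  case: pickP => [x /eqP //|no].
  have [|x xP] := frobenius_fixed iota (y := z * z ^+ q).
    by rewrite exprMn frobK mulrC.
  by have := no x; rewrite xP eqxx.
by exists (tr, nm).
Qed.

Variables (tr nm : K -> F).
Hypothesis trP : forall z, iota (tr z) = z + z ^+ q.
Hypothesis nmP : forall z, iota (nm z) = z * z ^+ q.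

Lemma trace_iota x : tr (iota x) = 2%:R * x.
Proof.
by apply: (fmorph_inj iota); rewrite trP frob_iota rmorphM rmorph_nat; ring.
Qed.

Lemma traceD : {morph tr : x y / x + y}.
Proof.
by move=> x y; apply: (fmorph_inj iota); rewrite rmorphD !trP frobD addrACA.
Qed.

Lemma additive_character_trace psi :
  additive_character psi -> additive_character (psi \o tr).
Proof.
case=> psiD psi1 [u uP]; split=> [x y|x|] /=; rewrite ?traceD ?psiD //.
by exists (iota (u / 2%:R)); rewrite /= trace_iota mulrC divfK.
Qed.

(* The roots of [X^2 - s X + n] lie in [F] or are conjugate in [K]. *)
Lemma card_trace_norm (w : F * F) :
  (#|[set z | (tr z, nm z) == w]| +
   #|[set u : F * F | ((u.1 + u.2)%R, (u.1 * u.2)%R) == w]| = 2)%N.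
Proof.
(* The total over all [w] is [|K| + |F|^2], twice the number of [w], so the bound 2 for each [w]
   suffices. *)
move: w; apply: sum_leq_const_eq => [[s n]|]; last first.
  by rewrite big_split /= !sum_card_fibers !card_prod card_K mul2n addnn -mulnn.
set A := [set z | _]; set B := [set u : F * F | _].
have AP z : z \in A -> z ^+ 2 = iota s * z - iota n.
  by rewrite inE => /eqP[<- <-]; rewrite trP nmP; ring.
have [->|/set0Pn[[x y]]] := eqVneq B finset.set0.
  rewrite cards0 addn0; have [->|/set0Pn[z0 z0A]] := eqVneq A finset.set0.
    by rewrite cards0.
  apply: leq_trans (subset_leq_card (_ : _ \subset [set z0; z0 ^+ q])) _; last first.
    by rewrite cards2; case: (_ != _).
  apply/fintype.subsetP => z zA; rewrite !inE -!(subr_eq0 z) -mulf_eq0.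
  have := AP _ zA; move: z0A; rewrite inE => /eqP[<- <-]; rewrite trP nmP => zE.
  by apply/eqP; transitivity (z ^+ 2 - (z0 + z0 ^+ q) * z + z0 * z0 ^+ q);
    [ring | rewrite zE; ring].
rewrite inE => /eqP[sE nE].
(* Once the quadratic splits in [F], an element of [A] is a root in [F]; its trace is twice itself
   and also [x + y], so the root is double. *)
have AB z : z \in A -> x = y /\ z = iota x.
  move=> zA; have zE := AP _ zA.
  have : (z == iota x) || (z == iota y).
    rewrite -!(subr_eq0 z) -mulf_eq0; apply/eqP.
    transitivity (z ^+ 2 - (iota x + iota y) * z + iota x * iota y); first ring.
    by rewrite zE -sE -nE rmorphD rmorphM; ring.
  move: zA; rewrite inE => /eqP[trz _] /orP[] /eqP zx; subst z.
    by split=> //; apply: (addrI x); rewrite sE -trz trace_iota; ring.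
  have yx : y = x by apply: (addrI y); rewrite [y + x]addrC sE -trz trace_iota; ring.
  by rewrite yx.
have BP u : u \in B -> u = (x, y) \/ u = (y, x).
  case: u => x' y'; rewrite inE /= => /eqP[sE' nE'].
  have : (x' == x) || (x' == y).
    rewrite -!(subr_eq0 x') -mulf_eq0; apply/eqP.
    transitivity (x' ^+ 2 - (x + y) * x' + x * y); first ring.
    by rewrite sE nE -sE' -nE'; ring.
  case/orP => /eqP xx; move: sE'; rewrite xx -sE; first by move/addrI ->; left.
  by rewrite [x + y]addrC => /addrI ->; right.
have [exy|nxy] := eqVneq x y.
  have : (#|A| <= 1)%N.
    rewrite -(cards1 (iota x)); apply/subset_leq_card/fintype.subsetP => z /AB[_ ->].
    by rewrite inE.
  have : (#|B| <= 1)%N.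
    rewrite -(cards1 (x, y)); apply/subset_leq_card/fintype.subsetP => z /BP.
    by rewrite exy inE => -[] ->.
  lia.
have -> : A = finset.set0.
  by apply/setP => z; rewrite [RHS]inE; apply/negP => /AB[/eqP]; rewrite (negPf nxy).
rewrite cards0 add0n.
apply: leq_trans (subset_leq_card (_ : _ \subset [set (x, y); (y, x)])) _.
  by apply/fintype.subsetP => u /BP; rewrite !inE => -[] ->; rewrite eqxx ?orbT.
by rewrite cards2; case: (_ != _).
Qed.

(** Both terms sum the same function of a pair (s, n): trace and norm of [z] in one, sum and product
    of [x, y] in the other, since [a x + b / x + a y + b / y = a s + b s / n]. By [card_trace_norm]
    every pair is counted twice in total. *)
Lemma kloosterman_doubling psi a b :
  additive_character psi -> a != 0 -> b != 0 ->
  kloosterman_sum (psi \o tr) (iota a) (iota b) + kloosterman_sum psi a b ^+ 2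
    = 2%:R * q%:R.
Proof.
move=> psiP a0 b0.
(* The value 0 at [w.2 = 0] discards [z = 0] and the pairs with a zero coordinate. *)
pose g (w : F * F) : algC := if w.2 == 0 then 0 else psi (a * w.1 + b * w.1 / w.2).
have -> : kloosterman_sum (psi \o tr) (iota a) (iota b) = \sum_z g (tr z, nm z).
  rewrite /kloosterman_sum big_mkcond; apply: eq_bigr => z _; rewrite /g /=.
  rewrite -(fmorph_eq0 iota (nm z)) nmP mulf_eq0 expf_eq0.
  have [->|z0] := eqVneq z 0; first by [].
  rewrite andbF /=; congr (psi _); apply: (fmorph_inj iota).
  rewrite trP rmorphD fmorph_div !rmorphM trP nmP frobD !exprMn exprVn !frob_iota.
  by field; rewrite z0 expf_neq0.
have -> : kloosterman_sum psi a b ^+ 2 =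
    \sum_(u : F * F) g (u.1 + u.2, u.1 * u.2).
  rewrite expr2 /kloosterman_sum mulr_suml big_mkcond /=.
  rewrite -(pair_big xpredT xpredT (fun x y => g (x + y, x * y))) /=.
  apply: eq_bigr => x _; rewrite /g /=.
  have [x0|x0] /= := eqVneq x 0.
    by rewrite big1 // => y _; rewrite x0 mul0r eqxx.
  rewrite mulr_sumr big_mkcond; apply: eq_bigr => y _.
  rewrite mulf_eq0 (negPf x0) /=; have [//|y0] := eqVneq y 0.
  by rewrite -(charD psiP); congr psi; field; rewrite ?x0 ?y0.
rewrite (sum_fibers (fun z => (tr z, nm z)) g).
rewrite (sum_fibers (fun u : F * F => (u.1 + u.2, u.1 * u.2)) g) -big_split /=.
rewrite (eq_bigr (fun w => 2%:R * g w)) => [|w _]; last first.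
  by rewrite -mulrnDr card_trace_norm mulr_natl.
rewrite -mulr_sumr; congr (_ * _).
rewrite -(pair_big xpredT xpredT (fun s n => g (s, n))) exchange_big /=.
(* The phase is [(a + b / n) s], so the sum over [s] vanishes unless [n = - b / a], where it is
   [q]. *)
rewrite (bigD1 (- b / a)) //= [X in _ + X]big1 ?addr0 => [|n nba].
  rewrite (eq_bigr (fun=> 1)) ?sumr_const // => s _.
  rewrite /g /= mulf_eq0 oppr_eq0 invr_eq0 (negPf a0) (negPf b0) /=.
  by rewrite -(char0 psiP); congr psi; field; rewrite ?a0 ?b0 ?oppr_eq0.
rewrite /g /=; have [//|n0] := eqVneq n 0; first by rewrite big1.
rewrite (eq_bigr (fun s => psi ((a + b / n) * s))) => [|s _]; last first.
  by congr psi; field.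
rewrite (sum_char psiP) ifN // addr_eq0; apply: contra nba => /eqP ->.
by apply/eqP; field; rewrite ?oppr_eq0 ?n0 ?b0.
Qed.

End QuadraticExtension.

(** * The Weil bound for Kloosterman sums, up to the constant *)

Section WeilBound.

Variables (F : finFieldType) (psi : F -> algC) (a b : F).
Hypothesis psiP : additive_character psi.
Hypothesis two_neq0 : 2%:R != 0 :> F.
Hypothesis a_neq0 : a != 0.
Hypothesis b_neq0 : b != 0.
Local Notation q := #|F|.

(* The Kloosterman sum of the lift of [psi] to the extension of degree [2 ^ m]. *)
Fixpoint lifted_kloosterman m : algC :=
  if m is m'.+1 then 2%:R * (q ^ 2 ^ m')%:R - lifted_kloosterman m' ^+ 2
  else kloosterman_sum psi a b.

(** The trace to [F] is given as a sum of Frobenius powers because that is the form counted by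
    [stepanov_bound]. *)
Lemma quadratic_tower m :
  exists (K : finFieldType) (iota : {rmorphism F -> K}) (tr : K -> F),
    [/\ #|K| = (q ^ 2 ^ m)%N,
        forall z, iota (tr z) = \sum_(e < 2 ^ m) z ^+ (q ^ e)%N,
        additive_character (psi \o tr)
      & kloosterman_sum (psi \o tr) (iota a) (iota b) = lifted_kloosterman m].
Proof.
elim: m => [|m [K [iota [tr [cardK trP psitr kl]]]]].
  exists F, idfun, id; split=> // z.
  by rewrite big_ord_recl big_ord0 addr0 expr1.
have two_K : 2%:R != 0 :> K by rewrite -(rmorph_nat iota) fmorph_eq0.
have [K' [iota' cardK']] := exists_quadratic_extension two_K.
have [[tr' nm'] /= [trP' nmP']] := exists_trace_norm iota' cardK'.
exists K', (iota' \o iota), (tr \o tr'); split.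
- by rewrite cardK' cardK -expnM -expnSr.
- move=> z; rewrite /= trP rmorph_sum /= expnS mul2n -addnn big_split_ord /=.
  rewrite -big_split; apply: eq_bigr => e _ /=.
  rewrite rmorphXn trP' cardK.
  by rewrite (frobeniusD (iota' \o iota)) -exprM -expnD.
- exact: (additive_character_trace two_K trP' psitr).
- have ia : iota a != 0 by rewrite fmorph_eq0.
  have ib : iota b != 0 by rewrite fmorph_eq0.
  have := kloosterman_doubling two_K cardK' trP' nmP' psitr ia ib.
  by rewrite kl cardK => /(canRL (addrK _)).
Qed.

(** Upper bounds [N c <= B] alone suffice: since the values of [psi] sum to 0, [N c] may be replaced
    by [N c - B], whose sign is constant. The norm is then at most [q B - (L^2 - 1) = 3 q L + 1]. *)
Lemma norm_lifted_kloosterman m :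
  `|lifted_kloosterman m.+1| <= (3 * q + 1)%:R * (q ^ 2 ^ m)%:R.
Proof.
have [K [iota [tr [cardK trP psitr <-]]]] := quadratic_tower m.+1.
pose f (z : K) := iota a * z + iota b / z.
pose N c := #|[set z | (z != 0) && (tr (f z) == c)]|.
set L := (q ^ 2 ^ m)%N.
have q_gt0 : (0 < q)%N by rewrite ltnW ?card_finNzRing_gt1.
have L_gt0 : (0 < L)%N by rewrite expn_gt0 q_gt0.
pose h := (2 ^ m).-1.
have hE : h.+1 = (2 ^ m)%N by rewrite prednK // expn_gt0.
pose B := (L * q ^ h + 3 * L)%N.
have NB c : (N c <= B)%N.
  rewrite /B /L -hE; apply: leq_trans (stepanov_bound (h := h) iota b c a_neq0 _).
    apply/subset_leq_card/fintype.subsetP => z; rewrite !inE => /andP[-> /eqP <-] /=.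
    by rewrite trP hE expnS mul2n addnn.
  by rewrite cardK hE -expnM expnSr.
have sumN : (\sum_c N c = (L ^ 2).-1)%N.
  rewrite -expnM -expnSr -cardK -(cardC1 (0 : K)) -sum1_card.
  rewrite (partition_big (fun z => tr (f z)) xpredT) //=; apply: eq_bigr => c _.
  by rewrite sum1_card; apply: eq_card => z; rewrite !inE.
have -> : kloosterman_sum (psi \o tr) (iota a) (iota b) =
    - \sum_c psi c * (B - N c)%:R.
  transitivity (\sum_c psi c * (N c)%:R).
    rewrite /kloosterman_sum (partition_big (fun z => tr (f z)) xpredT) //=.
    apply: eq_bigr => c _; rewrite (eq_bigr (fun=> psi c)) => [|z /andP[_ /eqP <-] //].
    by rewrite sumr_const mulr_natr; congr (_ *+ _); apply: eq_card => z; rewrite !inE.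
  have sum0 : \sum_c psi c = 0.
    transitivity (\sum_c psi (1 * c)); first by apply: eq_bigr => c; rewrite mul1r.
    by rewrite (sum_char psiP) oner_eq0.
  transitivity (\sum_c psi c * (N c)%:R - (\sum_c psi c) * B%:R).
    by rewrite sum0 mul0r subr0.
  rewrite mulr_suml -sumrB -sumrN.
  by apply: eq_bigr => c _; rewrite natrB // mulrBr opprB.
rewrite normrN; apply: le_trans (ler_norm_sum _ _ _) _.
rewrite (eq_bigr (fun c => (B - N c)%:R)) => [|c _]; last first.
  by rewrite normrM (norm_char psiP) mul1r normr_nat.
rewrite -natr_sum -natrM ler_nat; set S := (\sum_c _)%N.
have : (S + \sum_c N c = q * B)%N.
  rewrite /S -big_split /= (eq_bigr (fun=> B)) ?sum_nat_const // => c _.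
  by rewrite subnK.
rewrite sumN /B.
have -> : (q * (L * q ^ h + 3 * L) = L ^ 2 + 3 * q * L)%N.
  by rewrite /L -hE !expnS; ring.
have : (0 < L ^ 2)%N by rewrite expn_gt0 L_gt0.
by rewrite mulnDl mul1n; move: (L ^ 2)%N (3 * q * L)%N S => x y z; lia.
Qed.

(* Were the bound false, the doubling recursion would force the lifted sums to
   grow beyond the Stepanov bound. *)
Lemma norm_kloosterman_sum_neq0 : `|kloosterman_sum psi a b| ^+ 2 <= 9%:R * q%:R.
Proof.
rewrite real_leNgt ?realE ?exprn_ge0 ?mulr_ge0 ?ler0n ?normr_ge0 //.
apply/negP => lt_K.
pose D m := `|lifted_kloosterman m|.
have stepD m : D m ^+ 2 - 2%:R * (q ^ 2 ^ m)%:R <= D m.+1.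
  rewrite /D /= distrC -normrX.
  apply: le_trans (lerB_dist _ _).
  by rewrite -natrM normr_nat natrM.
(* The start uses [9 - 2 >= 4] and the induction [(4 + m)^2 - 2 >= 5 + m]. At [m = 3 q] the factor
   [4 + 3 q] exceeds the Stepanov constant [3 q + 1]. *)
have growth m : (4 + m)%:R * (q ^ 2 ^ m)%:R <= D m.+1.
  elim: m => [|m IH]; apply: le_trans (stepD _).
    rewrite lerBrDr -mulrDl -natrD expn1; apply: le_trans (ltW lt_K).
    by rewrite ler_wpM2r ?ler0n ?ler_nat.
  have : ((4 + m)%:R * (q ^ 2 ^ m)%:R) ^+ 2 <= D m.+1 ^+ 2 :> algC.
    by rewrite lerXn2r ?nnegrE ?mulr_ge0 ?ler0n ?normr_ge0.
  rewrite lerBrDr; apply: le_trans.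
  rewrite -mulrDl exprMn -!natrX -expnM -expnSr -natrD.
  rewrite ler_wpM2r ?ler0n // ler_nat; nia.
have := le_trans (growth (3 * q)%N) (norm_lifted_kloosterman _).
rewrite ler_pM2r; first by rewrite ler_nat; lia.
by rewrite ltr0n expn_gt0 ltnW ?card_finNzRing_gt1.
Qed.

End WeilBound.

Lemma norm_kloosterman_sum (F : finFieldType) (psi : F -> algC) (a b : F) :
  additive_character psi -> 2%:R != 0 :> F -> a != 0 ->
  `|kloosterman_sum psi a b| ^+ 2 <= 9%:R * #|F|%:R.
Proof.
move=> psiP two0 a0; have [->|b0] := eqVneq b 0; last exact: norm_kloosterman_sum_neq0.
have -> : kloosterman_sum psi a 0 = - 1.
  rewrite -[RHS]add0r -(_ : (if a == 0 then #|F|%:R else 0) = 0 :> algC); last by rewrite ifN.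
  by rewrite -(sum_char_neq0 psiP); apply: eq_bigr => x _; rewrite mul0r addr0.
rewrite normrN1 expr1n -natrM ler1n muln_gt0 /=.
by rewrite ltnW ?card_finNzRing_gt1.
Qed.

(** * Pairs at a given distance *)

Section DistanceCount.

Variables (F : finFieldType) (psi : F -> algC).
Hypothesis psiP : additive_character psi.
Hypothesis two_neq0 : 2%:R != 0 :> F.
Local Notation q := #|F|.
Local Notation G := (gauss_sum psi).

(** The square of the conjugate of [G s] equals [G 1 ^+ 2] for every [s != 0], since only signs
    vary. The even part of the power therefore leaves the sum with a known modulus, and only the
    parity of [d] remains. *)
Lemma norm_gauss_power_sum (d : nat) (a b : F) : b != 0 ->
  `|\sum_(s | s != 0) (G s)^* ^+ d * psi (a * s + b / s)| ^+ 2
    <= 9%:R * q%:R ^+ d.+1.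
Proof.
move=> b0; have N1 : (- 1 : F) != 0 by rewrite oppr_eq0 oner_neq0.
have [e eP] := gauss_sum_sign psiP N1.
have conjG s : s != 0 -> (G s)^* = (-1) ^+ e * G s.
  by move=> s0; rewrite (conj_gauss_sum psiP) -[- s]mulN1r eP.
have sqrG s : s != 0 -> (G s)^* ^+ 2 = G 1 ^+ 2.
  move=> s0; have [e' eP'] := gauss_sum_sign psiP s0.
  by rewrite conjG // -[s]mulr1 eP' ?oner_neq0 // !exprMn !sqrr_sign !mul1r.
have normG : `|G 1| ^+ 2 = q%:R by rewrite norm_gauss_sum ?oner_neq0.
rewrite -(odd_double_half d) -mul2n; set k := d./2.
have -> : \sum_(s | s != 0) (G s)^* ^+ (odd d + 2 * k) * psi (a * s + b / s) =
    G 1 ^+ 2 ^+ k * \sum_(s | s != 0) (G s)^* ^+ odd d * psi (a * s + b / s).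
  rewrite mulr_sumr; apply: eq_bigr => s s0.
  by rewrite exprD exprM sqrG // mulrA [X in X * _]mulrC.
rewrite normrM exprMn !normrX normG -exprM mulnC mulrC.
have -> : 9%:R * q%:R ^+ (odd d + 2 * k).+1 = 9%:R * q%:R ^+ (odd d).+1 * q%:R ^+ (2 * k) :> algC.
  by rewrite -mulrA -exprD addSn.
rewrite [(2 * k)%N]mulnC exprM; rewrite ler_wpM2r ?exprn_ge0 ?ler0n //.
(* In both cases the coefficients are swapped first: [b] is nonzero, whereas [a], later [sqnorm m],
   may vanish. *)
case: (odd d) => /=.
  have -> : \sum_(s | s != 0) (G s)^* ^+ 1 * psi (a * s + b / s) =
      (-1) ^+ e * salie_sum psi b a.
    rewrite salie_sumC // /salie_sum mulr_sumr; apply: eq_bigr => s s0.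
    by rewrite expr1 conjG // mulrA.
  rewrite normrMsign; apply: (@le_trans _ _ ((2%:R * q%:R) ^+ 2)).
    by rewrite lerXn2r ?nnegrE ?mulr_ge0 ?normr_ge0 ?ler0n // norm_salie_sum.
  by rewrite exprMn ler_wpM2r ?exprn_ge0 ?ler0n // -natrX ler_nat.
rewrite expr1; under eq_bigr => s _ do rewrite mul1r.
rewrite -/(kloosterman_sum psi a b) kloosterman_sumC.
exact: norm_kloosterman_sum.
Qed.

Variable d : nat.
Local Notation V := 'rV[F]_d.

Definition dotp (m z : V) : F := \sum_(i < d) m 0 i * z 0 i.

Lemma sum_row_prod (f : 'I_d -> F -> algC) :
  \sum_(m : V) \prod_(i < d) f i (m 0 i) = \prod_(i < d) \sum_x f i x.
Proof.
rewrite bigA_distr_bigA /=.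
rewrite (reindex (fun g : {ffun 'I_d -> F} => \row_i g i)) /=; last first.
  exists (fun m : V => [ffun i => m 0 i]) => [g _|m _].
    by apply/ffunP => i; rewrite ffunE mxE.
  by apply/rowP => i; rewrite mxE ffunE.
by apply: eq_bigr => g _; apply: eq_bigr => i _; rewrite mxE.
Qed.

Lemma sum_char_dotp (z : V) :
  \sum_m psi (dotp m z) = if z == 0 then q%:R ^+ d else 0.
Proof.
under eq_bigr => m _ do rewrite (char_sum psiP).
rewrite (sum_row_prod (fun i x => psi (x * z 0 i))).
have -> : \prod_(i < d) \sum_x psi (x * z 0 i) =
    \prod_(i < d) (if z 0 i == 0 then q%:R else 0 : algC).
  apply: eq_bigr => i _; rewrite -(sum_char psiP).
  by apply: eq_bigr => x _; rewrite mulrC.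
have [->|nz] := eqVneq z 0.
  rewrite (eq_bigr (fun=> q%:R)) => [|i _]; last by rewrite mxE eqxx.
  by rewrite prodr_const card_ord.
have [i zi] : exists i, z 0 i != 0.
  by apply/existsP; apply: contraR nz => /existsPn z0; apply/eqP/rowP => i;
    rewrite mxE; apply/eqP; have := z0 i; rewrite negbK.
by rewrite (bigD1 i) //= (negPf zi) mul0r.
Qed.

(** The sum factors over the coordinates, and in each one the square is completed by shifting by
    [z 0 i / (2 s)]. *)
Lemma sum_char_sqnorm (s : F) (z : V) : s != 0 ->
  \sum_m psi (s * sqnorm m + dotp m z) = psi (- sqnorm z / (4%:R * s)) * G s ^+ d.
Proof.
move=> s0.
have four0 : 4%:R != 0 :> F by rewrite (natrM _ 2 2) mulf_neq0.
transitivity (\sum_(m : V) \prod_(i < d) psi (s * m 0 i ^+ 2 + m 0 i * z 0 i)).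
  apply: eq_bigr => m _; rewrite -(char_sum psiP); congr psi.
  by rewrite big_split /= -mulr_sumr.
rewrite (sum_row_prod (fun i x => psi (s * x ^+ 2 + x * z 0 i))).
have -> : psi (- sqnorm z / (4%:R * s)) * G s ^+ d =
    \prod_(i < d) (psi (- (z 0 i) ^+ 2 / (4%:R * s)) * G s).
  rewrite big_split /= prodr_const card_ord -(char_sum psiP); congr (psi _ * _).
  by rewrite -mulr_suml sumrN.
apply: eq_bigr => i _; rewrite /gauss_sum mulr_sumr.
rewrite (reindex_inj (addIr (- (z 0 i / (2%:R * s))))) /=.
apply: eq_bigr => x _; rewrite -(charD psiP); congr psi.
by field; rewrite ?two_neq0 ?four0 ?s0.
Qed.

Variables (t : F) (E : {set V}).
Hypothesis t_neq0 : t != 0.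

Definition distance_pairs : {set V * V} :=
  [set u | [&& u.1 \in E, u.2 \in E & sqnorm (u.1 - u.2) == t]].

Let fourier (m : V) := \sum_(x in E) psi (dotp m x).

Let norm_fourier m :
  `|fourier m| ^+ 2 = \sum_(x in E) \sum_(y in E) psi (dotp m (x - y)).
Proof.
rewrite normCK rmorph_sum /fourier mulr_suml; apply: eq_bigr => x _.
rewrite mulr_sumr; apply: eq_bigr => y _ /=.
rewrite -(charN psiP) -(charD psiP); congr psi.
by rewrite /dotp -sumrB; apply: eq_bigr => i _; rewrite !mxE mulrBr.
Qed.

Let parseval : \sum_m `|fourier m| ^+ 2 = q%:R ^+ d * #|E|%:R.
Proof.
under eq_bigr => m _ do rewrite norm_fourier.
rewrite exchange_big /= -[#|E|]sum1_card natr_sum mulr_sumr; apply: eq_bigr => x xE.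
rewrite exchange_big /= (bigD1 x) //= [X in _ + X]big1 => [|y /andP[_ yx]].
  by rewrite sum_char_dotp subrr eqxx addr0 mulr1.
by rewrite sum_char_dotp subr_eq0 eq_sym (negPf yx).
Qed.

(** This is the Fourier transform of [q 1_S - 1], where [1_S] is the indicator of the sphere
    [sqnorm z = t]. *)
Let weight (m : V) := \sum_(s | s != 0) (G s)^* ^+ d * psi (sqnorm m * s + t / 4%:R / s).

Lemma distance_pairs_fourier :
  q%:R ^+ d * (q%:R * #|distance_pairs|%:R - #|E|%:R ^+ 2) =
    \sum_m `|fourier m| ^+ 2 * weight m.
Proof.
have four0 : 4%:R != 0 :> F by rewrite (natrM _ 2 2) mulf_neq0.
have countE : q%:R * #|distance_pairs|%:R =
    \sum_(x in E) \sum_(y in E) \sum_s psi ((sqnorm (x - y) - t) * s).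
  rewrite -[#|distance_pairs|]sum1_card natr_sum mulr_sumr big_mkcond.
  transitivity (\sum_x \sum_y if (x, y) \in distance_pairs then q%:R else 0 : algC).
    by rewrite pair_bigA /=; apply: eq_bigr => -[x y] _; rewrite mulr1.
  rewrite [RHS]big_mkcond; apply: eq_bigr => x _ /=.
  case: ifP => xE; last by rewrite big1 // => y _; rewrite inE /= xE.
  rewrite [RHS]big_mkcond; apply: eq_bigr => y _.
  by rewrite inE /= xE /= (sum_char psiP) subr_eq0; case: (y \in E).
have -> : q%:R * #|distance_pairs|%:R - #|E|%:R ^+ 2 =
    \sum_(x in E) \sum_(y in E) \sum_(s | s != 0)
       psi (- sqnorm (x - y) / (4%:R * s)) * psi (t / 4%:R / s).
  have -> : #|E|%:R ^+ 2 = \sum_(x in E) \sum_(y in E) 1 :> algC.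
    by rewrite !sumr_const -[RHS]mulr_natr expr2.
  rewrite countE -sumrB; apply: eq_bigr => x _; rewrite -sumrB.
  apply: eq_bigr => y _; rewrite (bigD1 0) //= mulr0 (char0 psiP) addrAC subrr add0r.
  (* After removing the term [s = 0], which gives [|E|^2], substituting [- 1 / (4 s)] for [s]
     produces the phase that [sum_char_sqnorm] leaves behind. *)
  have inj4 : injective (fun s : F => - (4%:R * s)^-1).
    by move=> s s' /oppr_inj /invr_inj /(mulfI four0).
  rewrite (reindex_inj inj4) /=; apply: eq_big => [s|s].
    by rewrite oppr_eq0 invr_eq0 mulf_eq0 (negPf four0).
  rewrite oppr_eq0 invr_eq0 mulf_eq0 (negPf four0) /= => s0.
  by rewrite -(charD psiP); congr psi; field; rewrite ?four0 ?s0.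
transitivity (\sum_m \sum_(x in E) \sum_(y in E) \sum_(s | s != 0)
   psi (dotp m (x - y)) * ((G s)^* ^+ d * psi (sqnorm m * s + t / 4%:R / s))); last first.
  apply: eq_bigr => m _; rewrite norm_fourier mulr_suml; apply: eq_bigr => x _.
  by rewrite mulr_suml; apply: eq_bigr => y _; rewrite mulr_sumr.
rewrite mulr_sumr exchange_big; apply: eq_bigr => x _ /=.
rewrite mulr_sumr exchange_big; apply: eq_bigr => y _ /=.
rewrite mulr_sumr exchange_big; apply: eq_bigr => s s0 /=.
(* Here [q^d] is written as [|G s|^(2 d)]: the factor [G s ^+ d] goes into the completed square and
   its conjugate stays in the weight. *)
transitivity ((G s)^* ^+ d * psi (t / 4%:R / s) *
    \sum_m psi (s * sqnorm m + dotp m (x - y))).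
  rewrite sum_char_sqnorm // -(norm_gauss_sum psiP two_neq0 s0) normCK exprMn; ring.
rewrite mulr_sumr; apply: eq_bigr => m _.
by rewrite !(charD psiP) [s * _]mulrC; ring.
Qed.

(** With [W = 3 q^((d+1)/2)] bounding the weights, Parseval bounds the error by [W |E|]. The
    hypothesis is [2 W <= |E|], so the error is at most half of [|E|^2]. *)
Lemma card_distance_pairs_ge :
  (36 * q ^ d.+1 <= #|E| ^ 2)%N -> (#|E| ^ 2 <= 2 * (q * #|distance_pairs|))%N.
Proof.
move=> largeE; pose W := sqrtC (9%:R * q%:R ^+ d.+1) : algC.
have W0 : 0 <= W by rewrite sqrtC_ge0 mulr_ge0 ?exprn_ge0 ?ler0n.
have normW m : `|weight m| <= W.
  rewrite -(@ler_pXn2r _ 2) ?nnegrE ?normr_ge0 // sqrtCK.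
  apply: norm_gauss_power_sum.
  by rewrite mulf_neq0 // invr_eq0 (natrM _ 2 2) mulf_neq0.
have q_gt0 : 0 < q%:R ^+ d :> algC.
  by rewrite exprn_gt0 // ltr0n ltnW ?card_finNzRing_gt1.
have boundN : `|q%:R * #|distance_pairs|%:R - #|E|%:R ^+ 2| <= W * #|E|%:R :> algC.
  rewrite -(ler_pM2l q_gt0) -{1}[q%:R ^+ d]ger0_norm ?(ltW q_gt0) // -normrM.
  rewrite distance_pairs_fourier; apply: le_trans (ler_norm_sum _ _ _) _.
  rewrite mulrCA -parseval mulr_sumr; apply: ler_sum => m _.
  by rewrite normrM normrX normr_id mulrC ler_wpM2r ?exprn_ge0 ?normr_ge0.
have WE : 2%:R * W <= #|E|%:R.
  rewrite -(@ler_pXn2r _ 2) ?nnegrE ?mulr_ge0 ?ler0n // exprMn sqrtCK mulrA.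
  by rewrite -!natrX -!natrM ler_nat.
have : #|E|%:R ^+ 2 - q%:R * #|distance_pairs|%:R <= W * #|E|%:R :> algC.
  by apply: le_trans boundN; rewrite distrC real_ler_norm.
rewrite -(ler_nat algC) natrX !natrM.
have : 2%:R * W * #|E|%:R <= #|E|%:R ^+ 2 :> algC.
  by rewrite expr2 ler_wpM2r ?ler0n.
set e := #|E|%:R ^+ 2; set n := q%:R * _; rewrite -mulrA; set w := W * _ => le2 le1.
have : 2%:R * (e - n) <= e by apply: le_trans le2; rewrite ler_wpM2l ?ler0n.
by rewrite mulrBr lerBlDr [2%:R * e]mulr_natl mulr2n lerD2l.
Qed.

End DistanceCount.

(** * From ordered pairs to edges of the distance graph *)

Lemma card_adj_pairs_le (H : sgraph) :
  (#|[set u : H * H | adj u.1 u.2]%SET| <= 2 * #|edges H|)%N.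
Proof.
rewrite -sum1_card (partition_big (fun u : H * H => [set u.1; u.2]%SET) (mem (edges H))) /=.
  rewrite mulnC -sum_nat_const; apply: leq_sum => A /imset2P[x y _].
  rewrite inE => /andP[_ xy] ->; rewrite sum1_card.
  apply: (@leq_trans #|[set (x, y); (y, x)]%SET|); last first.
    by rewrite cards2; case: (_ != _).
  apply/subset_leq_card/fintype.subsetP => -[u v].
  rewrite unfold_in => /andP[_ /eqP /= uv].
  have xuv : x \in [set u; v]%SET by rewrite uv set21.
  have yuv : y \in [set u; v]%SET by rewrite uv set22.
  have uxy : u \in [set x; y]%SET by rewrite -uv set21.
  have vxy : v \in [set x; y]%SET by rewrite -uv set22.
  move: xuv yuv uxy vxy; rewrite !inE.
  case/orP => /eqP ->; case/orP => /eqP ->; rewrite ?eqxx ?orbT //.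
  - by rewrite orbb => _ /eqP ->; rewrite eqxx.
  - by rewrite orbb => /eqP ->; rewrite eqxx.
move=> u; rewrite inE => adju; apply/imset2P; exists u.1 u.2 => //.
by rewrite inE adju.
Qed.

Lemma char_neq2 (F : finFieldType) : odd_prime_power #|F| -> 2%:R != 0 :> F.
Proof.
move=> [p [k [p_pr p_odd k_gt0 cardF]]]; apply/negP => /eqP two0.
have p2 : 2%N \in [pchar F] by rewrite inE /= two0 eqxx.
have pF := card_finPcharP cardF p_pr.
by move: p_odd; rewrite (pcharf_eq pF) ?inE // in p2; rewrite -(eqP p2).
Qed.

Lemma card_distance_pairs_le (F : finFieldType) (d : nat) (t : F)
    (E : {set 'rV[F]_d}) : t != 0 ->
  (#|distance_pairs t E| <= 2 * #|edges (distance_graph t E)|)%N.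
Proof.
move=> t0; apply: leq_trans (card_adj_pairs_le _).
pose f (u : distance_graph t E * distance_graph t E) := (val u.1, val u.2).
apply: leq_trans (leq_imset_card f _).
apply/subset_leq_card/fintype.subsetP => -[x y]; rewrite inE /= => /and3P[xE yE xy].
apply/imsetP; exists (exist _ x xE, exist _ y yE) => //.
rewrite inE /= /dist_adj /= xy andbT; apply: contra t0 => /eqP[exy].
by rewrite -(eqP xy) exy subrr /sqnorm big1 // => i _; rewrite mxE expr0n.
Qed.

Lemma card_distance_graph (F : finFieldType) (d : nat) (t : F)
    (E : {set 'rV[F]_d}) : #|distance_graph t E| = #|E|.
Proof. by rewrite card_sig; apply: eq_card => x; rewrite !inE. Qed.

Lemma edges_distance_graph_ge (F : finFieldType) (d : nat) (t : F)
    (E : {set 'rV[F]_d}) :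
  odd_prime_power #|F| -> t != 0 -> (36 * #|F| ^ d.+1 <= #|E| ^ 2)%N ->
  (#|E| ^ 2 <= 4 * #|F| * #|edges (distance_graph t E)|)%N.
Proof.
move=> /char_neq2 two0 t0 largeE.
have [psi psiP] := exists_additive_character F.
apply: leq_trans (card_distance_pairs_ge psiP two0 t0 largeE) _.
have := card_distance_pairs_le E t0; move: #|distance_pairs t E| => N.
move: #|edges _| #|F| => e q; nia.
Qed.

(** * Comparison with the extremal number *)

Local Open Scope classical_set_scope.

Theorem theorem1p9 (R : realType) (G : sgraph) (alpha : R)
    (alpha_gt0 : 0 < alpha)
    (ex_bound : exists C : R, 0 < C /\
       forall n : nat, (1 <= n)%N ->
         (extremal_number n G)%:R <= C * n%:R `^ (2 - alpha)) :
  exists c : R, 0 < c /\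
    forall (q : nat) (F : finFieldType), odd_prime_power q -> #|F| = q ->
    forall (d : nat) (E : {set 'rV[F]_d}), (1 <= d)%N ->
      c * q%:R `^ Num.max ((d%:R + 1) / 2) (1 / alpha) <= #|E|%:R ->
      [set: F] `\ 0 `<=` distance_set G E.
Proof.
case: ex_bound => C [C0 exC]; have C4 : 0 <= 4 * C by rewrite mulr_ge0 ?ltW.
(* The summand 6 yields [36 q^(d+1) <= |E|^2]; the other yields [|E|^alpha > 4 C q], strictly
   because 6 is positive. *)
exists (6 + (4 * C) `^ alpha^-1); split.
  by rewrite ltr_wpDr ?powR_ge0.
move=> q F q_odd cardF d E _ largeE t [_ /= /eqP t0].
apply: contrapT => noG.
have q1 : 1 <= q%:R :> R.
  by rewrite ler1n -cardF ltnW ?card_finNzRing_gt1.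
have q0 : 0 <= q%:R :> R by rewrite ler0n.
set M := q%:R `^ _ in largeE; set n : R := #|E|%:R in largeE *.
have M0 : 0 <= M by rewrite powR_ge0.
have n6 : 6 * q%:R `^ ((d%:R + 1) / 2) <= n.
  apply: le_trans largeE; apply: ler_pM; rewrite ?powR_ge0 //.
    by rewrite lerDl powR_ge0.
  by rewrite ler_powR // le_max lexx.
have nalpha : (4 * C) `^ alpha^-1 * q%:R `^ alpha^-1 < n.
  have qa : 0 < q%:R `^ alpha^-1 by rewrite powR_gt0 // (lt_le_trans ltr01).
  apply: (@lt_le_trans _ _ ((6 + (4 * C) `^ alpha^-1) * q%:R `^ alpha^-1)).
    by rewrite ltr_pM2r // ltrDr.
  apply: le_trans largeE; rewrite ler_wpM2l ?addr_ge0 ?powR_ge0 //.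
  by rewrite ler_powR // le_max div1r lexx orbT.
have n0 : 0 < n.
  by apply: le_lt_trans nalpha; rewrite mulr_ge0 ?powR_ge0.
have sqrE : (36 * #|F| ^ d.+1 <= #|E| ^ 2)%N.
  rewrite -(ler_nat R) natrM !natrX cardF.
  have -> : 36 * q%:R ^+ d.+1 = (6 * q%:R `^ ((d%:R + 1) / 2)) ^+ 2 :> R.
    rewrite exprMn -[(_ `^ _) ^+ 2]powR_mulrn ?powR_ge0 // -powRrM divfK ?pnatr_eq0 //.
    by rewrite natr1 powR_mulrn //; congr (_ * _); ring.
  by rewrite lerXn2r ?nnegrE ?mulr_ge0 ?powR_ge0 ?(ltW n0).
have := edges_distance_graph_ge _ _ sqrE.
rewrite cardF => /(_ t q_odd t0).
have := edges_le_extremal noG; rewrite card_distance_graph => le_ex.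
have {}exC := exC #|E| _.
rewrite -(ler_nat R) natrX !natrM => le_n2.
(* Without a copy of [G] the edge count is at most the extremal number. Dividing by [n^(2 - alpha)]
   gives [n^alpha <= 4 C q], contrary to [nalpha]. *)
have : n ^+ 2 <= 4 * q%:R * (C * n `^ (2 - alpha)).
  apply: le_trans le_n2 _; rewrite ler_wpM2l ?mulr_ge0 //.
  by apply: le_trans (exC _); rewrite ?ler_nat // -(ltr_nat R).
rewrite -powR_mulrn ?(ltW n0) // -{1}(subrK alpha 2%:R) powRD; last by rewrite (gt_eqF n0) implybT.
rewrite mulrC [_ * (C * _)]mulrA ler_pM2r ?powR_gt0 //.
apply/negP; rewrite -ltNge.
have -> : 4 * q%:R * C = ((4 * C) `^ alpha^-1 * q%:R `^ alpha^-1) `^ alpha.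
  rewrite -powRM // -powRrM mulVf ?gt_eqF // powRr1 ?mulr_ge0 ?(ltW C0) //; ring.
by apply: gt0_ltr_powR nalpha; rewrite ?nnegrE ?mulr_ge0 ?powR_ge0 // ltW.
Qed.
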